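(* Let $m\in\mathbb{Z}_+$, $d\in\mathbb{N}$, $M\subset\mathbb{Z}^d$. Let $B_0,\ldots,B_m$ be closed linear operators from $H$ to $H'$ with domains $\mathcal{D}(B_j)\subset H$ such that $e_{\mathbf{n}}\in\bigcap_{j=0}^m\mathcal{D}(B_j)$ for every $\mathbf{n}\in M$ and $(B_je_{\mathbf{n}'},B_je_{\mathbf{n}''})_{H'}=0$ for all $j\in\{0,\ldots,m\}$ and all $\mathbf{n}'\neq\mathbf{n}''$ in $M$. Let $A:H\to H'$ be a closable linear operator with domain $\mathcal{D}(A)\subset H$ such that $e_{\mathbf{n}}\in\mathcal{D}(A)$ for every $\mathbf{n}\in M$ and $(Ae_{\mathbf{n}'},Ae_{\mathbf{n}''})_{H'}=0$ for all $\mathbf{n}'\neq\mathbf{n}''$ in $M$. Let $\mathbf{k},\mathbf{r}^0,\ldots,\mathbf{r}^m\in\mathbb{R}^d$ and $\lambda_0,\ldots,\lambda_m>0$ be such that $\lambda_0+\ldots+\lambda_m=1$ and $\mathbf{k}=\lambda_0\mathbf{r}^0+\ldots+\lambda_m\mathbf{r}^m$ (so $\mathbf{k}$ belongs to the convex hull of $\mathbf{r}^0,\ldots,\mathbf{r}^m$). Let $\{g_n\}_{n\in\mathbb{Z}}\subset[0,+\infty)$ be a sequence such that for every $\mathbf{n}=(n_1,\ldots,n_d)\in M$ $$\|Ae_{\mathbf{n}}\|_{H'}=g_{\mathbf{n}}^{\mathbf{k}}:=g_{n_1}^{k_1}\cdots g_{n_d}^{k_d},\qquad \|B_je_{\mathbf{n}}\|_{H'}=g_{\mathbf{n}}^{\mathbf{r}^j}:=g_{n_1}^{r_1^j}\cdots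 g_{n_d}^{r_d^j},\quad j=0,1,\ldots,m,$$ and suppose there exists $\mathbf{n}_0\in M$ with $g_{\mathbf{n}_0}^{\mathbf{k}}\neq0$. Then for every $x\in\mathcal{D}(A)\cap H_{\mathbf{B}}$, $$\|Ax\|_{H'}\leqslant\prod_{j=0}^m\|B_jx\|_{H'}^{\lambda_j}.$$ This inequality turns into equality on every $e_{\mathbf{n}}$, $\mathbf{n}\in M$, such that $g_{\mathbf{n}}^{\mathbf{k}}\neq0$.
   Context: $\mathbb{Z}_+$ is the set of non-negative integers. $H$ is a separable Hilbert space over $\mathbb{C}$ with orthonormal basis $\{e_{\mathbf{n}}\}_{\mathbf{n}\in M}$ indexed by $M\subset\mathbb{Z}^d$; $x_{\mathbf{n}}:=(x,e_{\mathbf{n}})_H$. $H'$ is a Hilbert space over $\mathbb{C}$. $\mathbf{r}^j=(r_1^j,\ldots,r_d^j)$, where $j$ is an index. The convention $0^0:=1$ is used, and it is implicit in the assumptions that all the powers written are defined. $H_{\mathbf{B}}:=\{x\in H:\ \sum_{\mathbf{n}\in M}|x_{\mathbf{n}}|^2\|B_je_{\mathbf{n}}\|_{H'}^2<\infty,\ j=0,\ldots,m\}$; under the stated hypotheses on the $B_j$ one has $H_{\mathbf{B}}\subset\bigcap_{j=0}^m\mathcal{D}(B_j)$. An operator is closable if the closure of its graph is the graph of an operator. *)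

(* Defs.v *)
From mathcomp Require Import all_boot all_order all_algebra.
From mathcomp Require Import sesquilinear.
From mathcomp Require Import complex.
From mathcomp Require Import all_classical all_reals all_analysis.

Set Implicit Arguments.
Unset Strict Implicit.
Unset Printing Implicit Defensive.

Import Order.TTheory GRing.Theory Num.Theory.
Import numFieldNormedType.Exports.

Local Open Scope classical_set_scope.
Local Open Scope ring_scope.

(* Norms over [R[i]] (including the modulus on [R[i]] itself) are [R[i]]-valued; [rnorm v] is the same norm
   seen as an element of [R]. *)
Definition rnorm (R : realType) (V : normedZmodType R[i]) (v : V) : R :=
  complex.Re `|v|.

(* Inner products are linear in the first argument and conjugate-linear in the
   second one. A Hilbert space is a complete normed [R[i]]-module whose norm is
   the one induced by an inner product. *)
Definition hilbert_dot (R : realType) (V : completeNormedModType R[i])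
    (dot : {dot V for Num.conj}) : Prop :=
  forall x : V, `|x| ^+ 2 = dot x x.

Definition separable (T : topologicalType) : Prop :=
  exists D : set T, countable D /\ dense D.

Definition finspan (R : realType) (I : eqType) (V : normedModType R[i])
    (M : set I) (e : I -> V) : set V :=
  [set x | exists (s : seq I) (c : I -> R[i]),
    (forall n, n \in s -> M n) /\ x = \sum_(n <- s) c n *: e n].

(* The family is indexed by [M] only: the values of [e] outside [M] are
   irrelevant. *)
Definition orthonormal_basis (R : realType) (I : eqType)
    (V : completeNormedModType R[i]) (dot : {dot V for Num.conj})
    (M : set I) (e : I -> V) : Prop :=
  (forall n n', M n -> M n' -> dot (e n) (e n') = (n == n')%:R) /\
  dense (finspan M e).

(* A not necessarily bounded, not necessarily everywhere defined linear
   operator. The underlying function is total, but only its values on [opdom]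
   are meaningful. *)
Record operator (R : realType) (V W : normedModType R[i]) := Operator {
  opdom : set V ;
  opfun :> V -> W ;
  opdom0 : opdom 0 ;
  opdom_lin : forall (a : R[i]) (x y : V),
    opdom x -> opdom y -> opdom (a *: x + y) ;
  opfun_lin : forall (a : R[i]) (x y : V),
    opdom x -> opdom y -> opfun (a *: x + y) = a *: opfun x + opfun y
}.

Definition opgraph (R : realType) (V W : normedModType R[i])
    (T : operator V W) : set (V * W) :=
  [set p | opdom T p.1 /\ p.2 = T p.1].

Definition closed_operator (R : realType) (V W : normedModType R[i])
    (T : operator V W) : Prop := closed (opgraph T).

Definition closable_operator (R : realType) (V W : normedModType R[i])
    (T : operator V W) : Prop :=
  exists S : operator V W, closure (opgraph T) = opgraph S.

(* [multipow g k n] is g_{n_1}^{k_1} ... g_{n_d}^{k_d}; [powR] satisfies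
   0 `^ 0 = 1. *)
Definition multipow (R : realType) (d : nat) (g : int -> R) (k : 'rV[R]_d)
    (n : 'rV[int]_d) : R :=
  \prod_(i < d) g (n 0 i) `^ k 0 i.

(* [powR] is total, with 0 `^ a = 0 for a < 0; this predicate says that no such
   undefined power occurs in [multipow g k n]. *)
Definition multipow_defined (R : realType) (d : nat) (g : int -> R)
    (k : 'rV[R]_d) (n : 'rV[int]_d) : Prop :=
  forall i : 'I_d, g (n 0 i) = 0 -> 0 <= k 0 i.

Definition weighted_space (R : realType) (I : choiceType) (m : nat)
    (H H' : completeNormedModType R[i]) (dotH : {dot H for Num.conj})
    (M : set I) (e : I -> H) (B : 'I_m.+1 -> operator H H') : set H :=
  [set x | forall j : 'I_m.+1,
    (\esum_(n in M)
       (rnorm (dotH x (e n)) ^+ 2 * rnorm (B j (e n)) ^+ 2)%:E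
     < +oo)%E].

(* Main.v *)
Require Import Defs.
From mathcomp Require Import all_boot all_order all_algebra.
From mathcomp Require Import sesquilinear.
From mathcomp Require Import complex.
From mathcomp Require Import all_classical all_reals all_analysis.

Import Order.TTheory GRing.Theory Num.Theory.
Import numFieldNormedType.Exports.

Local Open Scope classical_set_scope.
Local Open Scope ring_scope.

(* Since the vectors [T e_n] are orthogonal, the partial sums of
   [x = sum x_n e_n] are mapped by [T] to vectors with squared norm
   [sum |x_n|^2 |T e_n|^2]. When these are bounded they form a Cauchy sequence,
   and the graph of [T] (for [B_j]) or its closure (for [A]) identifies the
   limit. The hypothesis on the norms says [|A e_n| = prod_j |B_j e_n|^lambda_j],
   so Hoelder's inequality for sums with the exponents [1 / lambda_j] bounds the
   partial sums of [A x] by [prod_j |B_j x|^(2 lambda_j)]; this provides both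
   their convergence and the estimate of the limit. *)

(** * Real powers, weighted means and the finite Hoelder inequality *)

Lemma powR_prod {R : realType} {J : Type} (s : seq J) (a : J -> R) (p : R) :
  (forall j, 0 <= a j) ->
  (\prod_(j <- s) a j) `^ p = \prod_(j <- s) a j `^ p.
Proof.
move=> a0; elim: s => [|j s IH]; first by rewrite !big_nil powR1.
by rewrite !big_cons powRM// ?IH// prodr_ge0.
Qed.

Lemma powR_sum {R : realType} {J : Type} (s : seq J) (x : R) (p : J -> R) :
  x != 0 -> x `^ (\sum_(j <- s) p j) = \prod_(j <- s) x `^ p j.
Proof.
move=> x0; elim: s => [|j s IH]; first by rewrite !big_nil powRr0.
by rewrite !big_cons powRD ?IH// x0 implybT.
Qed.

Lemma powR_sqr {R : realType} (x p : R) : 0 <= x -> (x ^+ 2) `^ p = (x `^ p) ^+ 2.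
Proof. by move=> x0; rewrite !expr2 powRM. Qed.

Lemma prod_powR_sum1 {R : realType} {J : finType} (l : J -> R) (x : R) :
  (forall j, 0 < l j) -> \sum_j l j = 1 -> 0 <= x -> \prod_j x `^ l j = x.
Proof.
move=> l0 l1 x0; have [->|xN0] := eqVneq x 0; last by rewrite -powR_sum// l1 powRr1.
(* At [x = 0] a single factor with positive exponent makes the product vanish. Such a factor exists:
   over an empty [J] the weights could not sum to 1. *)
have [j _|J0] := pickP (@predT J); first by rewrite (bigD1 j)//= powR0 ?mul0r ?gt_eqF.
by move: l1; rewrite !big_pred0// => /esym/eqP; rewrite oner_eq0.
Qed.

Lemma weighted_amgm {R : realType} {J : finType} (l a : J -> R) :
  (forall j, 0 < l j) -> \sum_j l j = 1 -> (forall j, 0 <= a j) ->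
  \prod_j a j `^ l j <= \sum_j l j * a j.
Proof.
move=> l0 l1 a0.
have [/existsP[j /eqP aj0]|/existsPn aN0] := boolP [exists j, a j == 0].
  rewrite (bigD1 j)//= aj0 powR0 ?mul0r ?gt_eqF//.
  by apply: sumr_ge0 => i _; rewrite mulr_ge0// ltW.
have {}a0 j : 0 < a j by rewrite lt_neqAle eq_sym aN0 a0.
set G := \prod_j _; have G0 : 0 < G by apply: prodr_gt0 => j _; exact: powR_gt0.
have lnG : ln G = \sum_j l j * ln (a j).
  rewrite -[RHS]expRK expR_sum; congr ln; apply: eq_bigr => j _.
  by rewrite -ln_powR lnK// posrE powR_gt0.
(* The tangent line bound [1 + ln t <= t] at [t = a j / G], averaged. *)
suff : \sum_j l j * (1 + (ln (a j) - ln G)) <= \sum_j l j * (a j / G).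
  under eq_bigr do rewrite mulrDr mulr1 mulrBr.
  under [leRHS]eq_bigr do rewrite mulrA.
  rewrite big_split sumrB -!mulr_suml l1 mul1r lnG subrr /= addr0.
  by rewrite ler_pdivlMr// mul1r.
apply: ler_sum => j _; rewrite ler_wpM2l ?(ltW (l0 j))//.
rewrite -ln_div ?posrE//; apply: le_trans (expR_ge1Dx _) _.
by rewrite lnK// posrE divr_gt0.
Qed.

(** Dividing each sequence [a j] by its total reduces the claim to the weighted AM-GM inequality,
    applied at every index [i] and then summed. *)
Lemma holder_sum {R : realType} {I : eqType} {J : finType} (s : seq I) (l : J -> R)
    (a : J -> I -> R) :
  (forall j, 0 < l j) -> \sum_j l j = 1 -> (forall j i, 0 <= a j i) ->
  \sum_(i <- s) \prod_j a j i `^ l j <=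
  \prod_j (\sum_(i <- s) a j i) `^ l j.
Proof.
move=> l0 l1 a0; pose t j := \sum_(i <- s) a j i.
have t0 j : 0 <= t j by exact: sumr_ge0.
(* Normalisation needs nonzero totals. If one total is zero, all its nonnegative terms are zero, and
   so is every product on the left. *)
have [/existsP[j /eqP tj0]|/existsPn tN0] := boolP [exists j, t j == 0].
  rewrite big_seq big1 => [|i si]; first by apply: prodr_ge0 => ? _; exact: powR_ge0.
  rewrite (bigD1 j)//=.
  suff -> : a j i = 0 by rewrite powR0 ?mul0r ?gt_eqF.
  move/eqP: tj0; rewrite psumr_eq0// => /allP/(_ _ si).
  by move/eqP.
have {}t0 j : 0 < t j by rewrite lt_neqAle eq_sym tN0 t0.
have P0 : 0 < \prod_j t j `^ l j by apply: prodr_gt0 => j _; exact: powR_gt0.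
rewrite -[leRHS]mul1r -ler_pdivrMr// mulr_suml.
have E : 1 = \sum_(i <- s) \sum_j l j * (a j i / t j).
  rewrite exchange_big /= -l1; apply: eq_bigr => j _.
  by rewrite -mulr_sumr -mulr_suml -/(t j) divff ?mulr1 ?gt_eqF.
rewrite [leRHS]E; apply: ler_sum => i _; rewrite -prodf_div.
have aE j : a j i `^ l j / t j `^ l j = (a j i / t j) `^ l j.
  rewrite powRM ?invr_ge0// ?(ltW (t0 j))//.
  by rewrite -(powR_inv1 (ltW (t0 j))) -powRrM mulN1r powRN.
under eq_bigr do rewrite aE.
by apply: weighted_amgm => // j; rewrite divr_ge0// ltW.
Qed.

Lemma multipow_convex {R : realType} {d : nat} {J : finType} (g : int -> R)
    (l : J -> R) (r : J -> 'rV[R]_d) (n : 'rV[int]_d) :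
  (forall z, 0 <= g z) -> (forall j, 0 < l j) ->
  (forall j, multipow_defined g (r j) n) ->
  multipow g (\sum_j l j *: r j) n = \prod_j multipow g (r j) n `^ l j.
Proof.
move=> g0 l0 rdef; rewrite /multipow.
under [RHS]eq_bigr do rewrite (powR_prod _ _ _ (fun _ => powR_ge0 _ _)).
rewrite [RHS]exchange_big /=; apply: eq_bigr => i _; rewrite summxE.
under [in LHS]eq_bigr do rewrite mxE.
under [RHS]eq_bigr do rewrite -powRrM mulrC.
have [gi0|gi0] := eqVneq (g (n 0 i)) 0; last exact: powR_sum.
rewrite gi0; have r0 j : 0 <= r j 0 i by exact: rdef.
have [/existsP[j rj]|/existsPn rN] := boolP [exists j, r j 0 i != 0].
  rewrite [RHS](bigD1 j)//= !powR0 ?mul0r ?mulf_neq0 ?(gt_eqF (l0 j))//.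
  rewrite psumr_eq0 ?mulr_ge0//; last first.
    by move=> k _; rewrite mulr_ge0// ltW.
  apply/negP => /allP/(_ j); rewrite mem_index_enum => /(_ isT).
  by rewrite implyTb mulf_eq0 (negbTE rj) gt_eqF.
have rE j : l j * r j 0 i = 0 by have /negPn/eqP-> := rN j; rewrite mulr0.
by rewrite !big1// ?powRr0// => j _; rewrite rE powRr0.
Qed.

(** * Norms and convergence expressed with real numbers *)

Lemma rnormE {R : realType} {V : normedZmodType R[i]} (v : V) : `|v| = ((rnorm v)%:C)%C.
Proof. by rewrite /rnorm RRe_real// normr_real. Qed.

Lemma rnorm_ge0 {R : realType} {V : normedZmodType R[i]} (v : V) : 0 <= rnorm v.
Proof. by rewrite -lecR -rnormE normr_ge0. Qed.

Lemma rnormZ {R : realType} {V : normedModType R[i]} (c : R[i]) (v : V) :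
  rnorm (c *: v) = rnorm c * rnorm v.
Proof. by apply: complexI; rewrite rmorphM/= -!rnormE normrZ. Qed.

Lemma ler_rnormD {R : realType} {V : normedZmodType R[i]} (u v : V) :
  rnorm (u + v) <= rnorm u + rnorm v.
Proof. by rewrite -lecR rmorphD/= -!rnormE ler_normD. Qed.

(** The usual criterion takes its radius in [R[i]]; a positive element there is real, hence equal to
    its real part, so real radii suffice. *)
Lemma cvg_rnormP {R : realType} {V : normedModType R[i]} (u : nat -> V) (l : V) :
  u @ \oo --> l <-> forall eps : R, 0 < eps -> \forall n \near \oo, rnorm (l - u n) < eps.
Proof.
split=> [/cvgrPdist_lt + eps eps0|h].
  move=> /(_ (eps%:C)%C); rewrite ltcR => /(_ eps0).
  by under eq_near do rewrite rnormE ltcR.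
apply/cvgrPdist_lt => eps eps0.
have := h (complex.Re eps).
have epsE : ((complex.Re eps)%:C)%C = eps by rewrite RRe_real// gtr0_real.
rewrite -ltcR epsE => /(_ eps0).
by apply: filterS => n; rewrite -ltcR epsE -rnormE.
Qed.

Lemma dot_rnorm {R : realType} {V : completeNormedModType R[i]}
    (dot : {dot V for Num.conj}) (hdot : hilbert_dot dot) (x : V) :
  dot x x = ((rnorm x ^+ 2)%:C)%C.
Proof. by rewrite rmorphXn/= -rnormE hdot. Qed.

(** * Orthogonality in a complex Hilbert space *)

Section Hilbert.
Context {R : realType} {V : completeNormedModType R[i]}.
Context (dot : {dot V for Num.conj}) (hdot : hilbert_dot dot).

Lemma dot_eq0C (x y : V) : dot x y = 0 -> dot y x = 0.
Proof. by move=> h; rewrite hermC/= h conjC0 mulr0. Qed.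

Lemma pythagoras (x y : V) : dot x y = 0 ->
  rnorm (x + y) ^+ 2 = rnorm x ^+ 2 + rnorm y ^+ 2.
Proof.
move=> h; apply: complexI; rewrite rmorphD/= -!(dot_rnorm _ hdot).
by rewrite linearDl /= !linearDr /= h (dot_eq0C _ _ h) addr0 add0r.
Qed.

Lemma dot_sumr {I : Type} (s : seq I) (c : I -> R[i]) (f : I -> V) (x : V) :
  dot x (\sum_(i <- s) c i *: f i) = \sum_(i <- s) (c i)^* * dot x (f i).
Proof. by rewrite linear_sumr/=; apply: eq_bigr => i _; rewrite linearZr_LR. Qed.

Lemma rnorm_sum_orthogonal {I : eqType} (s : seq I) (c : I -> R[i]) (f : I -> V) :
  uniq s -> {in s &, forall i j, i <> j -> dot (f i) (f j) = 0} ->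
  rnorm (\sum_(i <- s) c i *: f i) ^+ 2 =
  \sum_(i <- s) rnorm (c i) ^+ 2 * rnorm (f i) ^+ 2.
Proof.
elim: s => [_ _|i s IH /= /andP[si us] orth].
  by rewrite !big_nil /rnorm normr0 expr0n.
rewrite !big_cons pythagoras ?rnormZ ?exprMn ?IH//.
  by move=> j k js ks; apply: orth; rewrite inE ?js ?ks orbT.
rewrite linearZl_LR/= dot_sumr big_seq big1 ?mulr0// => j js.
rewrite orth ?mulr0// ?mem_head// ?inE ?js ?orbT//.
by move=> ij; rewrite ij js in si.
Qed.

Lemma dot_suml {I : Type} (s : seq I) (c : I -> R[i]) (f : I -> V) (x : V) :
  dot (\sum_(i <- s) c i *: f i) x = \sum_(i <- s) c i * dot (f i) x.
Proof. by rewrite linear_sumlz/=; apply: eq_bigr => i _; rewrite linearZl_LR. Qed.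

End Hilbert.

(** * Exhaustion of a countable index set by finite lists *)

Definition enum_prefix {I : countType} (M : set I) (n : nat) : seq I :=
  [seq i <- pmap pickle_inv (iota 0 n) | `[< M i >]].

Section EnumPrefix.
Context {I : countType} (M : set I).

Lemma mem_enum_prefix (n : nat) (i : I) :
  (i \in enum_prefix M n) = `[< M i >] && (pickle i < n)%N.
Proof.
rewrite mem_filter mem_pmap; congr (_ && _); apply/mapP/idP => [[k]|ltn].
  rewrite mem_iota add0n => ltn /esym ik.
  by have := @pickle_invK I k; rewrite ik /= => ->.
by exists (pickle i); rewrite ?mem_iota// pickleK_inv.
Qed.

Lemma enum_prefix_uniq (n : nat) : uniq (enum_prefix M n).
Proof. exact/filter_uniq/(pmap_uniq (@pickle_invK I))/iota_uniq. Qed.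

(** Listing by increasing [pickle] code makes the lists nested as prefixes, so the difference of two
    partial sums is again a sum over a list. *)
Lemma enum_prefix_cat (p n : nat) : (p <= n)%N ->
  exists s, enum_prefix M n = enum_prefix M p ++ s.
Proof.
move=> /subnKC <-; rewrite /enum_prefix iotaD pmap_cat filter_cat.
by eexists.
Qed.

Lemma enum_prefix_le {R : realType} (w : I -> R) (p n : nat) :
  (forall i, 0 <= w i) -> (p <= n)%N ->
  \sum_(i <- enum_prefix M p) w i <= \sum_(i <- enum_prefix M n) w i.
Proof.
move=> w0 /enum_prefix_cat[s ->]; rewrite big_cat/= lerDl.
exact: sumr_ge0.
Qed.

Lemma sum_enum_prefix_le_esum {R : realType} (w : I -> R) (n : nat) :
  ((\sum_(i <- enum_prefix M n) w i)%:E <= \esum_(i in M) (w i)%:E)%E.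
Proof.
apply: esum_ge; exists [set` enum_prefix M n].
  split; first exact: finite_seq.
  by move=> i /=; rewrite mem_enum_prefix => /andP[/asboolP].
by rewrite -fsbig_seq ?enum_prefix_uniq// sumEFin.
Qed.

End EnumPrefix.

(** * Convergence of orthogonal expansions *)

Section Expansion.
Context {R : realType} {I : countType} {V : completeNormedModType R[i]}.
Context (dot : {dot V for Num.conj}) (hdot : hilbert_dot dot) (M : set I).

Lemma basis_expansion (e : I -> V) (x : V) :
  orthonormal_basis dot M e ->
  (fun n => \sum_(i <- enum_prefix M n) dot x (e i) *: e i) @ \oo --> x.
Proof.
move=> [eM dense_e]; apply/cvg_rnormP => eps eps0.
have [||y [/interior_subset bxy [s [c [sM ye]]]]] := dense_e (ball x (eps%:C)%C)^°.
- by exists x; apply: nbhsx_ballx; rewrite ltcR.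
- exact: open_interior.
move: bxy; rewrite -ball_normE/= rnormE ltcR => xy.
(* From this threshold on, every code in [s] is strictly below [n], so the [n]-th list contains all
   of [s]. *)
exists (\max_(i <- s) (pickle i).+1)%N => // n /= sn.
apply: le_lt_trans xy; set S := \sum_(i <- _) _.
have orth i : i \in enum_prefix M n -> dot (x - S) (e i) = 0.
  move=> iE; have := iE; rewrite mem_enum_prefix => /andP[/asboolP Mi _].
  rewrite linearBl/= dot_suml (bigD1_seq i)//= ?enum_prefix_uniq//.
  rewrite eM// eqxx mulr1 big_seq_cond big1 ?addr0 ?subrr// => j.
  rewrite mem_enum_prefix => /andP[/andP[/asboolP Mj _] ji].
  by rewrite eM// (negbTE ji) mulr0.
(* [S] is the best approximation of [x] in the span of the first vectors, which
   contains [y]. *)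
have orth_sum t a : {subset t <= enum_prefix M n} ->
    dot (x - S) (\sum_(i <- t) a i *: e i) = 0.
  move=> tE; rewrite dot_sumr big_seq big1// => i /tE iE.
  by rewrite orth ?mulr0.
have oSy : dot (x - S) (S - y) = 0.
  rewrite linearBr/= {2}/S ye !orth_sum ?subrr// => i iE.
  rewrite mem_enum_prefix (asboolT (sM _ iE)) (leq_trans _ sn)//.
  exact: (@leq_bigmax_seq _ s xpredT (fun i => (pickle i).+1)).
rewrite -ler_sqr ?nnegrE ?rnorm_ge0//.
have -> : x - y = (x - S) + (S - y) by rewrite addrA subrK.
by rewrite (pythagoras _ hdot _ _ oSy) lerDl sqr_ge0.
Qed.

(** By Pythagoras the squared distance between two partial sums is a difference of terms of the
    nondecreasing bounded sequence [W]. Completeness then gives the limit, and the bounds on the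
    partial sums pass to it. *)
Lemma orthogonal_series_cvg (c : I -> R[i]) (f : I -> V) (C : R) :
  let w i := rnorm (c i) ^+ 2 * rnorm (f i) ^+ 2 in
  (forall i j, M i -> M j -> i <> j -> dot (f i) (f j) = 0) ->
  (forall n, \sum_(i <- enum_prefix M n) w i <= C) ->
  exists z, [/\ (fun n => \sum_(i <- enum_prefix M n) c i *: f i) @ \oo --> z,
    forall n, \sum_(i <- enum_prefix M n) w i <= rnorm z ^+ 2 &
    rnorm z ^+ 2 <= C].
Proof.
move=> w orth; have w0 i : 0 <= w i by rewrite mulr_ge0 ?sqr_ge0.
set y := fun n => \sum_(i <- _) _; pose W n := \sum_(i <- enum_prefix M n) w i => WC.
have inM n i : i \in enum_prefix M n -> M i.
  by rewrite mem_enum_prefix => /andP[/asboolP].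
have yE n : rnorm (y n) ^+ 2 = W n.
  apply: rnorm_sum_orthogonal => //; first exact: enum_prefix_uniq.
  by move=> i j /inM Mi /inM Mj; exact: orth.
have dyE p n : (p <= n)%N -> rnorm (y p - y n) ^+ 2 = W n - W p.
  move=> pn; have [s sE] := enum_prefix_cat M p n pn.
  have := enum_prefix_uniq M n; rewrite sE cat_uniq => /and3P[_ _ us].
  rewrite /y /W sE !big_cat/= opprD addrA subrr sub0r addrAC subrr add0r.
  rewrite /rnorm normrN -/(rnorm _); apply: rnorm_sum_orthogonal => //.
  by move=> i j si sj; apply: orth; apply: (inM n); rewrite sE mem_cat ?si ?sj orbT.
have ndW : {homo W : p n / (p <= n)%N >-> p <= n} by move=> p n; exact: enum_prefix_le.
have supW : has_sup (range W).
  by split; [exists (W 0%N); exists 0%N|exists C => _ [n _ <-]; exact: WC].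
have /cauchy_cvgP/cvg_ex[z yz] : cauchy (y @ \oo).
  apply: cauchy_exP => eps eps0.
  have epsE : ((complex.Re eps)%:C)%C = eps by rewrite RRe_real// gtr0_real.
  have Re0 : 0 < complex.Re eps by rewrite -ltcR epsE.
  (* [W p] is chosen within the square of the radius of the supremum, so every later [W n] exceeds
     it by less than that square. *)
  have [_ [p _ <-] ltp] := sup_adherent (exprn_gt0 2 Re0) supW.
  exists (y p); exists p => // n /= pn.
  rewrite -ball_normE/= rnormE -epsE ltcR -ltr_sqr ?nnegrE ?rnorm_ge0 ?(ltW Re0)//.
  rewrite dyE// ltrBlDr -ltrBlDl; apply: le_lt_trans ltp.
  by rewrite lerD2r; apply: ub_le_sup; [case: supW|exists n].
have near_z n eps : 0 < eps -> exists2 p, (n <= p)%N & rnorm (z - y p) < eps.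
  move=> eps0; have /cvg_rnormP/(_ _ eps0)[p _ yp] := yz.
  by exists (maxn n p); [exact: leq_maxl|exact/yp/leq_maxr].
have C0 : 0 <= C by apply: le_trans (WC 0%N); exact: sumr_ge0.
exists z; split=> // [n|].
  (* The norms of the partial sums are nondecreasing, so [y n] is compared with a later [y p] that
     is within [eps] of [z]. *)
  rewrite -/(W n) -yE ler_sqr ?nnegrE ?rnorm_ge0//.
  apply/ler_addgt0Pr => eps /(near_z n)[p np zp].
  have yy : rnorm (y n) <= rnorm (y p) by rewrite -ler_sqr ?nnegrE ?rnorm_ge0// !yE ndW.
  apply: (le_trans yy); rewrite -[y p](subKr z).
  by apply: le_trans (ler_rnormD _ _) _; rewrite lerD2l /rnorm normrN ltW.
rewrite -[C]sqr_sqrtr// ler_sqr ?nnegrE ?rnorm_ge0 ?sqrtr_ge0//.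
apply/ler_addgt0Pr => eps /(near_z 0%N)[p _ zp].
rewrite -[z](subrK (y p)) addrC; apply: le_trans (ler_rnormD _ _) _.
apply: lerD _ (ltW zp).
by rewrite -ler_sqr ?nnegrE ?rnorm_ge0 ?sqrtr_ge0// yE sqr_sqrtr//; exact: WC.
Qed.

End Expansion.

(** * Unbounded operators and closures of their graphs *)

Section Operator.
Context {R : realType} {V W : normedModType R[i]} (T : operator V W).

Lemma opfun0 : T 0 = 0.
Proof.
have := opfun_lin 1 (opdom0 T) (opdom0 T); rewrite scaler0 addr0 scale1r.
by move/eqP; rewrite -subr_eq0 opprD addNKr oppr_eq0 => /eqP.
Qed.

Lemma op_sum {I : eqType} (s : seq I) (c : I -> R[i]) (e : I -> V) :
  {in s, forall i, opdom T (e i)} ->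
  opdom T (\sum_(i <- s) c i *: e i) /\
  T (\sum_(i <- s) c i *: e i) = \sum_(i <- s) c i *: T (e i).
Proof.
elim: s => [_|i s IH edom]; first by rewrite !big_nil opfun0; split=> //; exact: opdom0.
have [|sdom sE] := IH; first by move=> j js; apply: edom; rewrite inE js orbT.
have idom := edom i (mem_head _ _).
by rewrite !big_cons -sE; split; [exact: opdom_lin|exact: opfun_lin].
Qed.

Lemma cvg_closure_opgraph (u : nat -> V) (x : V) (z : W) :
  (forall n, opdom T (u n)) -> u @ \oo --> x -> (T \o u) @ \oo --> z ->
  closure (opgraph T) (x, z).
Proof.
move=> udom ux Tuz.
apply: (@closed_cvg _ _ \oo _ (fun n => (u n, T (u n))) (closure (opgraph T))).
- exact: closed_closure.
- by apply: nearW => n; apply: subset_closure; exact: (conj (udom n) erefl).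
- exact: cvg_pair ux Tuz.
Qed.

(** The closure of the graph is itself a graph, hence single-valued, and it also contains
    [(x, T x)]. *)
Lemma closable_operatorE (x : V) (z : W) : closable_operator T ->
  closure (opgraph T) (x, z) -> opdom T x -> T x = z.
Proof.
move=> [S SE]; rewrite SE => -[_ /= ->] xdom.
have : closure (opgraph T) (x, T x).
  by apply: subset_closure; exact: (conj xdom erefl).
by rewrite SE => -[].
Qed.

End Operator.

(** This serves closed and closable operators alike: the conclusion places [(x, z)] only in the
    closure of the graph, leaving the identification of [z] with [T x] to the caller. *)
Lemma op_expansion {R : realType} {I : countType} {H H' : completeNormedModType R[i]}
    (dotH : {dot H for Num.conj}) (dotH' : {dot H' for Num.conj}) (M : set I)
    (e : I -> H) (T : operator H H') (x : H) (C : R) :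
  hilbert_dot dotH -> hilbert_dot dotH' -> orthonormal_basis dotH M e ->
  (forall i, M i -> opdom T (e i)) ->
  (forall i j, M i -> M j -> i <> j -> dotH' (T (e i)) (T (e j)) = 0) ->
  let w i := rnorm (dotH x (e i)) ^+ 2 * rnorm (T (e i)) ^+ 2 in
  (forall n, \sum_(i <- enum_prefix M n) w i <= C) ->
  exists z, [/\ closure (opgraph T) (x, z),
    forall n, \sum_(i <- enum_prefix M n) w i <= rnorm z ^+ 2 &
    rnorm z ^+ 2 <= C].
Proof.
move=> hH hH' e_basis Tdom Torth w wC.
have [z [Tz wz zC]] := orthogonal_series_cvg _ hH' _ _ _ _ Torth wC.
exists z; split=> //.
pose S n := \sum_(i <- enum_prefix M n) dotH x (e i) *: e i.
have ST n : opdom T (S n) /\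
    T (S n) = \sum_(i <- enum_prefix M n) dotH x (e i) *: T (e i).
  by apply: op_sum => i; rewrite mem_enum_prefix => /andP[/asboolP/Tdom].
apply: (@cvg_closure_opgraph _ _ _ _ S) => [n||].
- by have [] := ST n.
- exact: basis_expansion.
- by have -> : T \o S = fun n => \sum_(i <- enum_prefix M n) dotH x (e i) *: T (e i)
    by apply/funext => n; exact: (ST n).2.
Qed.

(** * The multiplicative inequality and its equality case on basis vectors *)

Theorem theorem9 (R : realType)
  (H : completeNormedModType R[i]) (dotH : {dot H for Num.conj})
  (hilbertH : hilbert_dot dotH) (separableH : separable H)
  (H' : completeNormedModType R[i]) (dotH' : {dot H' for Num.conj})
  (hilbertH' : hilbert_dot dotH')
  (m d : nat) (d_gt0 : (0 < d)%N) (M : set 'rV[int]_d)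
  (e : 'rV[int]_d -> H) (e_basis : orthonormal_basis dotH M e)
  (B : 'I_m.+1 -> operator H H')
  (B_closed : forall j, closed_operator (B j))
  (B_dom : forall j n, M n -> opdom (B j) (e n))
  (B_orth : forall j n' n'', M n' -> M n'' -> n' <> n'' ->
     dotH' (B j (e n')) (B j (e n'')) = 0)
  (A : operator H H') (A_closable : closable_operator A)
  (A_dom : forall n, M n -> opdom A (e n))
  (A_orth : forall n' n'', M n' -> M n'' -> n' <> n'' ->
     dotH' (A (e n')) (A (e n'')) = 0)
  (k : 'rV[R]_d) (r : 'I_m.+1 -> 'rV[R]_d) (lambda : 'I_m.+1 -> R)
  (lambda_gt0 : forall j, 0 < lambda j)
  (lambda_sum1 : \sum_(j < m.+1) lambda j = 1)
  (k_comb : k = \sum_(j < m.+1) lambda j *: r j)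
  (g : int -> R) (g_ge0 : forall n, 0 <= g n)
  (gk_def : forall n, M n -> multipow_defined g k n)
  (gr_def : forall j n, M n -> multipow_defined g (r j) n)
  (A_norm : forall n, M n -> rnorm (A (e n)) = multipow g k n)
  (B_norm : forall j n, M n -> rnorm (B j (e n)) = multipow g (r j) n)
  (g_nontrivial : exists n0, M n0 /\ multipow g k n0 <> 0) :
  (forall x : H, opdom A x -> weighted_space dotH M e B x ->
     rnorm (A x) <= \prod_(j < m.+1) rnorm (B j x) `^ lambda j) /\
  (forall n, M n -> multipow g k n <> 0 ->
     rnorm (A (e n)) = \prod_(j < m.+1) rnorm (B j (e n)) `^ lambda j).
Proof.
have gE n : M n -> multipow g k n = \prod_j multipow g (r j) n `^ lambda j.
  by move=> Mn; rewrite k_comb multipow_convex// => j; exact: gr_def.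
split=> [x xA xB|n Mn _]; last first.
  by rewrite A_norm// gE//; apply: eq_bigr => j _; rewrite B_norm.
pose w (T : operator H H') i := rnorm (dotH x (e i)) ^+ 2 * rnorm (T (e i)) ^+ 2.
have inM n i : i \in enum_prefix M n -> M i.
  by rewrite mem_enum_prefix => /andP[/asboolP].
(* The bound [C] is the full weighted sum, finite because [x] lies in the weighted space. Closedness
   of [B j] gives [z = B j x], whose squared norm dominates each partial sum. *)
have Bx j n : \sum_(i <- enum_prefix M n) w (B j) i <= rnorm (B j x) ^+ 2.
  have esum_fin : (\esum_(i in M) (w (B j) i)%:E)%E \is a fin_num.
    rewrite ge0_fin_numE ?xB// esum_ge0// => i _.
    by rewrite lee_fin mulr_ge0 ?sqr_ge0.
  have [||z [+ wz _]] := op_expansion _ _ _ _ (B j) x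
      (fine (\esum_(i in M) (w (B j) i)%:E)%E) hilbertH hilbertH' e_basis (B_dom j).
  - exact: B_orth.
  - by move=> p; rewrite -lee_fin fineK// sum_enum_prefix_le_esum.
  - rewrite -(closure_id _).1; last exact: B_closed.
    by move=> [_ /= <-]; exact: wz.
pose P := \prod_(j < m.+1) rnorm (B j x) `^ lambda j.
have P0 : 0 <= P by apply: prodr_ge0 => j _; exact: powR_ge0.
have Ax n : \sum_(i <- enum_prefix M n) w A i <= P ^+ 2.
  (* Each weight of [A] is the geometric mean of the weights of the [B j]: since the exponents sum
     to 1, the common factor [rnorm (dotH x (e i)) ^+ 2] is the product of its own powers. *)
  have -> : \sum_(i <- enum_prefix M n) w A i =
      \sum_(i <- enum_prefix M n) \prod_j w (B j) i `^ lambda j.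
    apply: eq_big_seq => i /inM Mi; rewrite /w A_norm// gE//.
    have wE j : (rnorm (dotH x (e i)) ^+ 2 * rnorm (B j (e i)) ^+ 2) `^ lambda j =
        (rnorm (dotH x (e i)) ^+ 2) `^ lambda j * (multipow g (r j) i `^ lambda j) ^+ 2.
      rewrite B_norm// powRM ?sqr_ge0// (powR_sqr (multipow _ _ _))//.
      by apply: prodr_ge0 => ? _; exact: powR_ge0.
    under [RHS]eq_bigr do rewrite wE.
    by rewrite big_split /= prod_powR_sum1 ?sqr_ge0// prodrXl.
  apply: le_trans (holder_sum _ _ _ lambda_gt0 lambda_sum1 _) _.
    by move=> j i; rewrite mulr_ge0 ?sqr_ge0.
  rewrite -prodrXl; apply: ler_prod => j _; rewrite powR_ge0/=.
  rewrite -powR_sqr ?rnorm_ge0// ge0_ler_powR ?nnegrE ?sqr_ge0 ?(ltW (lambda_gt0 j))//.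
  by apply: sumr_ge0 => i _; rewrite mulr_ge0 ?sqr_ge0.
(* With [P ^+ 2] as bound, the limit satisfies the desired estimate; closability and [x] in the
   domain of [A] identify it with [A x]. *)
have [z [Az _ zP]] :=
  op_expansion _ _ _ _ A x (P ^+ 2) hilbertH hilbertH' e_basis A_dom A_orth Ax.
by rewrite (closable_operatorE _ _ _ A_closable Az xA) -ler_sqr ?nnegrE ?rnorm_ge0.
Qed.
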